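(* Let $y\in Y$ and let $p_0,\dots,p_{N-1}$ be positive numbers with $\sum_{i\in\Sigma_N}p_i=1$. Assume that for some $\epsilon_0>0$, some $l\ge1$ and some $i_1,\dots,i_l\in\Sigma_N$, $$Y(y)\cap\bigcap_{i\in\Sigma_N}G_i^{-1}\left([p_i-\epsilon_0,p_i+\epsilon_0]\right)\cap\bigcap_{j\in\Sigma_N}\left(G_j\circ H_{i_l}\circ\cdots\circ H_{i_1}\right)^{-1}\left([p_j-\epsilon_0,p_j+\epsilon_0]\right)=\emptyset .$$ Then: (i) $\nu_y$ is singular with respect to $\nu_{(p_0,\dots,p_{N-1})}$. (ii) If moreover $\pi^{-1}(\pi(A))\setminus A$ is at most countable for every subset $A$ of $(\Sigma_N)^{\mathbb{N}}$, then $\mu_y$ is singular with respect to $\mu_{(p_0,\dots,p_{N-1})}$.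
   Context: Let $N\ge2$, $\Sigma_N=\{0,\dots,N-1\}$. Let $S_i$, $i\in\Sigma_N$, be contractive similitudes of a Euclidean space $\mathbb{R}^d$ with a common contraction ratio in $(0,1)$, satisfying the open set condition, and let $K$ be the attractor of $\{S_i\}_{i\in\Sigma_N}$. Let $\pi:(\Sigma_N)^{\mathbb{N}}\to K$ be the natural projection, i.e. the unique map with $\pi(ix)=S_i(\pi(x))$ for all $i\in\Sigma_N$, $x\in(\Sigma_N)^{\mathbb{N}}$ ($ix$ denotes concatenation). Let $Y$ be a set and $H_i:Y\to Y$, $G_i:Y\to[0,1]$, $i\in\Sigma_N$, be maps with $\sum_iG_i(y)=1$ for all $y\in Y$. For $y\in Y$ let $Y(y)=\{H_{i_l}\circ\cdots\circ H_{i_1}(y): i_1,\dots,i_l\in\Sigma_N,\ l\ge1\}$. Let $\nu_y$ be the unique probability measure on $(\Sigma_N)^{\mathbb{N}}$ (product $\sigma$-algebra) such that the cylinder set of sequences beginning with $i_1,\dots,i_n$ has measure $\prod_{k=1}^nG_{i_k}(H_{i_{k-1}}\circ\cdots\circ H_{i_1}(y))$, and let $\mu_y=\nu_y\circ\pi^{-1}$. For $p_i\geq 0$ with $\sum_i p_i=1$, $\nu_{(p_0,\dots,p_{N-1})}$ is the Bernoulli (i.i.d. product) measure on $(\Sigma_N)^{\mathbb{N}}$ with weights $(p_i)$, and $\mu_{(p_0,\dots,p_{N-1})}=\nu_{(p_0,\dots,p_{N-1})}\circ\pi^{-1}$ is the corresponding self-similar measure on $K$. *)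

(* Defs.v *)
From HB Require Import structures.
From mathcomp Require Export all_boot all_order all_algebra.
From mathcomp Require Export all_classical all_reals.
From mathcomp Require Export ereal topology normedtype.
From mathcomp Require Export measure.

Set Implicit Arguments.
Unset Strict Implicit.
Unset Printing Implicit Defensive.

Export Order.TTheory GRing.Theory Num.Theory numFieldNormedType.Exports.

Global Open Scope classical_set_scope.
Global Open Scope ring_scope.

(* Measurable types are pointed, so the alphabet {0, ..., N-1}, N >= 2, is
   written 'I_n.+2, with N = n.+2.  Its sigma-algebra is the discrete one. *)
HB.instance Definition _ (n : nat) := isPointed.Build 'I_n.+2 ord0.

Definition seq_generators (n : nat) : set (set (nat -> 'I_n.+2)) :=
  [set B | exists (k : nat) (A : set 'I_n.+2), B = (fun x => x k) @^-1` A].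

Definition seqspace (n : nat) := g_sigma_algebraType (@seq_generators n).
HB.instance Definition _ n := Measurable.on (seqspace n).

Definition borel_rV (R : realType) (d : nat) :=
  g_sigma_algebraType (@open 'rV[R]_d).
HB.instance Definition _ R d := Measurable.on (borel_rV R d).

Definition scons (n : nat) (i : 'I_n.+2) (x : nat -> 'I_n.+2) :
    nat -> 'I_n.+2 :=
  fun k => if k is k'.+1 then x k' else i.

Definition cylinder (n m : nat) (w : m.-tuple 'I_n.+2) : set (seqspace n) :=
  [set x : nat -> 'I_n.+2 | forall k : 'I_m, x k = tnth w k].

Definition mutually_singular (d : measure_display) (T : measurableType d)
    (R : realType) (mu nu : set T -> \bar R) : Prop :=
  exists A : set T,
    [/\ measurable A, mu A = 0%E & nu (~` A) = 0%E].

(* The norm of 'rV[R]_d in the library is the sup norm; it has the same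
   topology as the Euclidean norm, but different similitudes. *)
Definition eucl_norm (R : realType) (d : nat) (x : 'rV[R]_d) : R :=
  Num.sqrt (\sum_(k < d) (x 0 k) ^+ 2).

Definition similitude (R : realType) (d : nat) (r : R)
    (f : 'rV[R]_d -> 'rV[R]_d) : Prop :=
  forall x y, eucl_norm (f x - f y) = r * eucl_norm (x - y).

Definition open_set_condition (R : realType) (d n : nat)
    (S : 'I_n.+2 -> 'rV[R]_d -> 'rV[R]_d) : Prop :=
  exists V : set 'rV[R]_d,
    [/\ open V, V !=set0,
        forall i, S i @` V `<=` V
      & forall i j, i != j -> S i @` V `&` S j @` V = set0].

Definition attractor (R : realType) (d n : nat)
    (S : 'I_n.+2 -> 'rV[R]_d -> 'rV[R]_d) (K : set 'rV[R]_d) : Prop :=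
  [/\ compact K, K !=set0 & K = \bigcup_i (S i @` K)].

Definition natural_projection (R : realType) (d n : nat)
    (S : 'I_n.+2 -> 'rV[R]_d -> 'rV[R]_d) (K : set 'rV[R]_d)
    (pi : (nat -> 'I_n.+2) -> 'rV[R]_d) : Prop :=
  (forall x, K (pi x)) /\ (forall i x, pi (scons i x) = S i (pi x)).

(* [:: i_1; ...; i_l] is sent to H_{i_l} \o ... \o H_{i_1}. *)
Definition Hcomp (n : nat) (Y : Type) (H : 'I_n.+2 -> Y -> Y)
    (w : seq 'I_n.+2) (y : Y) : Y :=
  foldl (fun z i => H i z) y w.

Definition reach (n : nat) (Y : Type) (H : 'I_n.+2 -> Y -> Y) (y : Y) : set Y :=
  [set z | exists2 w : seq 'I_n.+2, (1 <= size w)%N & z = Hcomp H w y].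

Definition is_nu (R : realType) (n : nat) (Y : Type) (H : 'I_n.+2 -> Y -> Y)
    (G : 'I_n.+2 -> Y -> R) (y : Y) (nu : probability (seqspace n) R) : Prop :=
  forall (m : nat) (w : m.-tuple 'I_n.+2),
    nu (cylinder w) = (\prod_(k < m) G (tnth w k) (Hcomp H (take k w) y))%:E.

Definition is_bernoulli (R : realType) (n : nat) (p : 'I_n.+2 -> R)
    (nu : probability (seqspace n) R) : Prop :=
  forall (m : nat) (w : m.-tuple 'I_n.+2),
    nu (cylinder w) = (\prod_(k < m) p (tnth w k))%:E.

(* Main.v *)
(* For the Hellinger affinity
     a_m(z) = sum over words u of length m of sqrt (nu_z [u] * nu_p [u]),
   splitting off the first letter gives
     a_(m+1)(z) = sum_i sqrt (G_i(z) p_i) a_m(H_i z),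
   and sum_i sqrt (g_i p_i) = 1 - (1/2) sum_i (sqrt g_i - sqrt p_i)^2.  The
   hypothesis says that for every z in Y(y) the weights G(z) or G(H_w z) are
   bounded away from p.  Either way the affinity over the next l + 1 letters is
   at most some c < 1: in the second case either nu_z [w] is of the order of
   nu_p [w] > 0 and a loss occurs after w, or it is much smaller and the loss
   occurs along w.  Hence a_m(y) tends to 0 exponentially fast.  The event
   C_m = {nu_y [x_1 .. x_m] > nu_p [x_1 .. x_m]} satisfies nu_p (C_m) <= a_m(y)
   and nu_y (~ C_m) <= a_m(y), so by Borel-Cantelli L = liminf C_m, along an
   arithmetic progression, is nu_p-null with nu_y-null complement.
   As C_m is clopen, L is sigma-compact, hence pi(L) is Borel; pi^-1(pi(L))
   exceeds L by a countable set, which is nu_p-null because nu_p has no atoms,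
   so pi(L) separates the two projected measures.  (The possible atoms of nu_y
   are harmless.) *)
From HB Require Import structures.
Require Import Defs.
From mathcomp Require Import ring lra sequences.

Set Implicit Arguments.
Unset Strict Implicit.
Unset Printing Implicit Defensive.

(** * Hellinger affinity *)

Section Affinity.
Context (R : realType) (n : nat) (Y : Type).
Context (H : 'I_n.+2 -> Y -> Y) (G : 'I_n.+2 -> Y -> R) (p : 'I_n.+2 -> R).
Hypothesis G01 : forall i y, 0 <= G i y <= 1.
Hypothesis Gsum : forall y, \sum_i G i y = 1.
Hypothesis p_gt0 : forall i, 0 < p i.
Hypothesis psum : \sum_i p i = 1.

(* Hellinger affinity of the laws of the first [m] letters under [nu_z] and
   under the Bernoulli measure; see [affinity_tuple]. *)
Fixpoint affinity (m : nat) (z : Y) : R :=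
  if m is m'.+1 then \sum_i Num.sqrt (G i z * p i) * affinity m' (H i z) else 1.

Lemma affinity_ge0 m z : 0 <= affinity m z.
Proof.
elim: m z => [|m IH] z /=; first exact: ler01.
by apply: sumr_ge0 => i _; rewrite mulr_ge0 ?sqrtr_ge0.
Qed.

(** With $g = G_i(z)$ one has $\sqrt{g p_i} = (g + p_i)/2 - (\sqrt g - \sqrt{p_i})^2/2$. Both weight
    vectors sum to 1, so what remains is 1 minus nonnegative losses, of which only the one at [j] is
    kept. *)
Lemma sum_sqrt_le z j :
  \sum_i Num.sqrt (G i z * p i) <=
  1 - (Num.sqrt (G j z) - Num.sqrt (p j)) ^+ 2 / 2.
Proof.
have -> : \sum_i Num.sqrt (G i z * p i) =
    1 - \sum_i (Num.sqrt (G i z) - Num.sqrt (p i)) ^+ 2 / 2.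
  transitivity (\sum_i ((G i z + p i) / 2 -
      (Num.sqrt (G i z) - Num.sqrt (p i)) ^+ 2 / 2)); last first.
    by rewrite sumrB; congr (_ - _); rewrite -mulr_suml big_split /= Gsum psum; field.
  apply: eq_bigr => i _; have /andP[G0 _] := G01 i z.
  by rewrite sqrtrM // -{2}(sqr_sqrtr G0) -{2}(sqr_sqrtr (ltW (p_gt0 i))); field.
rewrite lerD2l lerN2 (bigD1 j) //= lerDl.
by apply: sumr_ge0 => i _; rewrite divr_ge0 ?sqr_ge0.
Qed.

Lemma affinity_le1 m z : affinity m z <= 1.
Proof.
elim: m z => [//|m IH] z /=.
apply: (@le_trans _ _ (\sum_i Num.sqrt (G i z * p i))).
  by apply: ler_sum => i _; rewrite ler_piMr ?sqrtr_ge0.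
apply: (le_trans (sum_sqrt_le z ord0)).
by rewrite gerBl divr_ge0 ?sqr_ge0.
Qed.

Lemma affinityS_le m z : affinity m.+1 z <= affinity 1 z.
Proof. by apply: ler_sum => i _; rewrite ler_wpM2l ?sqrtr_ge0 ?affinity_le1. Qed.

Lemma p_le1 i : p i <= 1.
Proof.
by rewrite -psum (bigD1 i) //= lerDl; apply: sumr_ge0 => j _; exact: ltW.
Qed.

(** For the square roots [s] of [G j z] and [q] of [p j], the deviation factors through [s - q] and
    [s + q <= 2]; hence [(s - q) ^+ 2 / 2] is at least [eps ^+ 2 / 8]. *)
Lemma affinity1_le (eps : R) z j : 0 < eps -> eps < `|G j z - p j| ->
  affinity 1 z <= 1 - eps ^+ 2 / 8.
Proof.
move=> eps0 dev; rewrite /= (eq_bigr (fun i => Num.sqrt (G i z * p i))); last first.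
  by move=> i _; rewrite mulr1.
apply: (le_trans (sum_sqrt_le z j)); rewrite lerD2l lerN2.
have /andP[G0 G1] := G01 j z; have q1 := p_le1 j.
have q0 := ltW (p_gt0 j).
set s := Num.sqrt (G j z); set q := Num.sqrt (p j).
have s0 : 0 <= s := sqrtr_ge0 _.
have qq0 : 0 <= q := sqrtr_ge0 _.
have s2 : s ^+ 2 = G j z := sqr_sqrtr G0.
have q2 : q ^+ 2 = p j := sqr_sqrtr q0.
have s1 : s <= 1 by rewrite -sqrtr1; exact: ler_wsqrtr.
have qq1 : q <= 1 by rewrite -sqrtr1; exact: ler_wsqrtr.
have : eps ^+ 2 <= (G j z - p j) ^+ 2.
  by rewrite -(real_normK (num_real (G j z - p j))) lerXn2r ?nnegrE //= ltW.
have -> : (G j z - p j) ^+ 2 = (s - q) ^+ 2 * (s + q) ^+ 2.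
  by rewrite -s2 -q2; ring.
have h4 : (s + q) ^+ 2 <= 4.
  have : (s + q) ^+ 2 <= (2 : R) ^+ 2 by rewrite lerXn2r ?nnegrE //; lra.
  by move=> h; apply: (le_trans h); lra.
have := ler_wpM2l (sqr_ge0 (s - q)) h4.
lra.
Qed.

(** A loss after [v] is carried back to its start at the price of a factor [p i / 2] per letter. The
    factor survives even where [G i z] is small or zero, because such a letter causes a Hellinger
    loss of its own. *)
Lemma affinity_word_le (v : seq 'I_n.+2) (del : R) z :
  0 <= del <= 1 -> affinity 1 (Hcomp H v z) <= 1 - del ->
  affinity (size v).+1 z <= 1 - del * \prod_(i <- v) (p i / 2).
Proof.
move=> /andP[del0 del1]; elim: v z => [|i v IH] z.
  by rewrite big_nil mulr1.
rewrite [Hcomp _ _ _]/= big_cons => /IH {}IH.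
set del' := del * \prod_(j <- v) (p j / 2) in IH.
have prod01 : 0 <= \prod_(j <- v) (p j / 2) <= 1.
  elim: v {IH del'} => [|j v /andP[h0 h1]]; first by rewrite big_nil ler01 lexx.
  have pj := p_gt0 j; have pj1 := p_le1 j.
  by rewrite big_cons; apply/andP; split; nra.
have /andP[d0 d1] : 0 <= del' <= 1 by rewrite /del'; apply/andP; split; nra.
have -> : del * (p i / 2 * \prod_(j <- v) (p j / 2)) = del' * (p i / 2).
  by rewrite /del'; ring.
(* The induction hypothesis serves the branch [i]; on all other branches the affinity is bounded by
   1. *)
have step : affinity (size v).+2 z <=
    \sum_j Num.sqrt (G j z * p j) - Num.sqrt (G i z * p i) * del'.
  rewrite -/(affinity _ _) [X in X <= _]/= -/affinity.
  rewrite (bigD1 i) //= [in X in _ <= X](bigD1 i) //= -/affinity.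
  rewrite addrAC; apply: lerD; last first.
    by apply: ler_sum => j _; exact: ler_piMr (sqrtr_ge0 _) (affinity_le1 _.+1 _).
  rewrite -{2}[Num.sqrt _]mulr1 -mulrBr.
  by apply: ler_wpM2l; rewrite ?sqrtr_ge0.
apply: (le_trans step); have := sum_sqrt_le z i.
have /andP[G0 _] := G01 i z.
rewrite (sqrtrM _ G0) -{3}(sqr_sqrtr (ltW (p_gt0 i))).
have s0 := sqrtr_ge0 (G i z); have q0 := sqrtr_ge0 (p i).
move: (Num.sqrt _) (Num.sqrt (p i)) (\sum_j _) s0 q0 => s q S s0 q0 hS.
(* Since [del' <= 1], the loss [(s - q)^2 / 2 + s q del'] is at least
   [del' ((s - q)^2 / 2 + s q) = del' (s^2 + q^2) / 2]. *)
have h1 : del' * (s - q) ^+ 2 <= (s - q) ^+ 2 by rewrite ler_piMl ?sqr_ge0.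
have h2 : 0 <= del' * s ^+ 2 by rewrite mulr_ge0 ?sqr_ge0.
rewrite !expr2 in h1 h2 hS *; nra.
Qed.

(** The bound [c] will be available only on the orbit of [y], hence the invariant set [Z], which the
    state never leaves while letters are peeled off. *)
Lemma affinity_addn_le (Z : set Y) (c : R) m k z :
  (forall i u, Z u -> Z (H i u)) -> (forall u, Z u -> affinity m u <= c) ->
  Z z -> affinity (k + m) z <= affinity k z * c.
Proof.
move=> ZH Zc; elim: k z => [|k IH] z Zz; first by rewrite mul1r; exact: Zc.
rewrite addSn /= mulr_suml; apply: ler_sum => i _.
by rewrite -mulrA ler_wpM2l ?sqrtr_ge0 ?IH //; exact: ZH.
Qed.

Lemma affinity_muln_le (Z : set Y) (c : R) k z : 0 <= c ->
  (forall i u, Z u -> Z (H i u)) -> (forall u, Z u -> affinity k u <= c) ->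
  forall m, Z z -> affinity (m * k) z <= c ^+ m.
Proof.
move=> c0 ZH Zc m; elim: m z => [|m IH] z Zz; first by rewrite expr0.
rewrite mulSn exprS; apply: (le_trans (@affinity_addn_le Z _ _ _ _ ZH IH Zz)).
by rewrite ler_wpM2r ?exprn_ge0 ?Zc.
Qed.

Definition nu_weight z m (u : m.-tuple 'I_n.+2) : R :=
  \prod_(k < m) G (tnth u k) (Hcomp H (take k u) z).

Definition bernoulli_weight m (u : m.-tuple 'I_n.+2) : R :=
  \prod_(k < m) p (tnth u k).

Lemma nu_weight_ge0 z m (u : m.-tuple 'I_n.+2) : 0 <= nu_weight z u.
Proof. by apply: prodr_ge0 => k _; have /andP[] := G01 (tnth u k) (Hcomp H (take k u) z). Qed.

Lemma bernoulli_weight_ge0 m (u : m.-tuple 'I_n.+2) : 0 <= bernoulli_weight u.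
Proof. by apply: prodr_ge0 => k _; exact: ltW. Qed.

(** Splitting a tuple into head and tail factors both weights, which matches the recursion defining
    [affinity]. *)
Lemma affinity_tuple m z :
  \sum_(u : m.-tuple 'I_n.+2) Num.sqrt (nu_weight z u * bernoulli_weight u) =
  affinity m z.
Proof.
elim: m z => [|m IH] z.
  rewrite (bigD1 [tuple]) //= big1; last by move=> u /eqP[]; exact: tuple0.
  by rewrite addr0 /nu_weight /bernoulli_weight !big_ord0 mulr1 sqrtr1.
have consK : {on xpredT, bijective (fun iu : 'I_n.+2 * m.-tuple 'I_n.+2 =>
    [tuple of iu.1 :: iu.2])}.
  exists (fun u => (thead u, [tuple of behead u])).
    by case=> i u _ /=; congr (_, _); apply: val_inj.
  by move=> u _ /=; rewrite -tuple_eta.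
rewrite (reindex _ consK) /=.
under [RHS]eq_bigr do rewrite -IH mulr_sumr.
rewrite pair_bigA; apply: eq_bigr => -[i u] _ /=.
have -> : nu_weight z [tuple of i :: u] = G i z * nu_weight (H i z) u.
  rewrite /nu_weight big_ord_recl /= tnth0; congr (_ * _).
  by apply: eq_bigr => k _; rewrite tnthS.
have -> : bernoulli_weight [tuple of i :: u] = p i * bernoulli_weight u.
  rewrite /bernoulli_weight big_ord_recl /= tnth0; congr (_ * _).
  by apply: eq_bigr => k _; rewrite tnthS.
have /andP[G0 _] := G01 i z.
by rewrite mulrACA sqrtrM // mulr_ge0 // ltW.
Qed.

End Affinity.

(** * Singularity on the symbolic space *)

Lemma eseries_expr_fin (R : realType) (c : R) : 0 < c < 1 ->
  (\sum_(k <oo) (c ^+ k)%:E < +oo)%E.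
Proof.
move=> /andP[c0 c1]; apply: (@le_lt_trans _ _ (1 / (1 - c))%:E); last exact: ltry.
apply: lime_le.
  by apply: is_cvg_nneseries => k _ _; rewrite lee_fin exprn_ge0 // ltW.
apply: nearW => k; rewrite sumEFin lee_fin.
have := @geometric_le_lim R k 1 c ler01 c0.
rewrite gtr0_norm // /series /= => /(_ c1); apply: le_trans.
by rewrite le_eqVlt; apply/orP; left; apply/eqP; apply: eq_bigr => i _; rewrite mul1r.
Qed.

Lemma measure_bigsetU_le d (T : measurableType d) (R : realType)
    (mu : {measure set T -> \bar R}) (I : Type) (s : seq I) (P : pred I)
    (F : I -> set T) :
  (forall i, measurable (F i)) ->
  (mu (\big[setU/set0]_(i <- s | P i) F i) <= \sum_(i <- s | P i) mu (F i))%E.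
Proof.
move=> mF; elim: s => [|i s IH]; first by rewrite !big_nil measure0.
rewrite !big_cons; case: ifP => // _.
apply: (@le_trans _ _ (mu (F i) + mu (\big[setU/set0]_(j <- s | P j) F j))%E).
  by apply: measureU2 => //; exact: bigsetU_measurable.
exact: leeD2l.
Qed.

(* Borel-Cantelli applied to [C] under [nu] and to the complements under [mu]. *)
Lemma singular_of_geometric d (T : measurableType d) (R : realType)
    (mu nu : {measure set T -> \bar R}) (C : nat -> set T) (c : R) :
  0 < c < 1 -> (forall k, measurable (C k)) ->
  (forall k, mu (~` C k) <= (c ^+ k)%:E)%E ->
  (forall k, nu (C k) <= (c ^+ k)%:E)%E ->
  mu (~` \bigcup_k \bigcap_(j >= k) C j) = 0%E /\
  nu (\bigcup_k \bigcap_(j >= k) C j) = 0%E.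
Proof.
move=> c01 mC muC nuC.
have null (m : {measure set T -> \bar R}) (D : nat -> set T) :
    (forall k, measurable (D k)) -> (forall k, m (D k) <= (c ^+ k)%:E)%E ->
    m (lim_sup_set D) = 0%E.
  move=> mD mDc; apply: lim_sup_set_cvg0 => //.
  apply: le_lt_trans (eseries_expr_fin c01); apply: lee_nneseries => // k _.
have mL : measurable (\bigcup_k \bigcap_(j >= k) C j).
  by apply: bigcup_measurable => k _; apply: bigcap_measurable => //; exists k => /=.
split.
  have <- : lim_sup_set (fun k => ~` C k) = ~` \bigcup_k \bigcap_(j >= k) C j.
    rewrite setC_bigcup; apply: eq_bigcapr => k _.
    by rewrite setC_bigcap.
  by apply: null => // k; exact: measurableC.
apply: (@subset_measure0 _ _ _ _ _ (lim_sup_set C)) => //.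
- by apply: bigcap_measurable => // k _; apply: bigcup_measurable => j _.
- move=> x [k _ Cx] i _; exists (maxn i k) => /=; first exact: leq_maxl.
  by apply: Cx => /=; exact: leq_maxr.
- exact: null.
Qed.

Section SeqSpace.
Context (n : nat).
Local Notation letters := 'I_n.+2.

Lemma measurable_coord k (A : set letters) :
  measurable ((fun x : nat -> letters => x k) @^-1` A : set (seqspace n)).
Proof. by apply: sub_gen_smallest; exists k, A. Qed.

Lemma cylinder_measurable m (u : m.-tuple letters) : measurable (cylinder u).
Proof.
have -> : cylinder u = \bigcap_(k in [set: 'I_m])
    ((fun x : nat -> letters => x k) @^-1` [set tnth u k] : set (seqspace n)).
  by apply/seteqP; split=> x /= h k; [move=> _; exact: h | exact: h].
by apply: fin_bigcap_measurable => // k _; exact: measurable_coord.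
Qed.

Lemma set1_measurable (x : seqspace n) : measurable [set x].
Proof.
have -> : [set x] = \bigcap_k
    ((fun z : nat -> letters => z k) @^-1` [set (x : nat -> letters) k]
       : set (seqspace n)).
  apply/seteqP; split=> [z -> k _ //|z zx].
  by apply/funext => k; exact: zx.
by apply: bigcap_measurable => // k _; exact: measurable_coord.
Qed.

Definition letters_upto m (x : nat -> letters) : m.-tuple letters :=
  [tuple x k | k < m].

Context (R : realType).

(** There are no atoms: a cylinder of length [m] has mass at most [q ^+ m], where [q < 1] is the
    largest weight. *)
Lemma bernoulli_countable0 (p : letters -> R) (nu : probability (seqspace n) R)
    (A : set (seqspace n)) :
  (forall i, 0 < p i) -> \sum_i p i = 1 -> is_bernoulli p nu ->
  countable A -> nu A = 0%E.
Proof.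
move=> p0 p1 nuP cA.
have mA : measurable A.
  by apply: countable_measurable => // x; exact: set1_measurable.
have [q q0 [q1 pq]] : exists2 q : R, 0 <= q & q < 1 /\ forall i, p i <= q.
  exists (\big[Num.max/0]_i p i); first exact: bigmax_ge_id.
  split; last by move=> i; exact: le_bigmax.
  apply: bigmax_lt => // i _.
  (* A second letter of positive weight forces [p i < 1]. *)
  have [j ji] : exists j : letters, j != i.
    by case: (eqVneq i ord0) => [->|]; [exists ord_max | exists ord0; rewrite eq_sym].
  rewrite -p1 (bigD1 i) //= (bigD1 j) //= ltrDl ltr_pwDl //.
  by apply: sumr_ge0 => k _; exact: ltW.
have atom x : nu [set x] = 0%E.
  apply/eqP; rewrite eq_le measure_ge0 andbT.
  have le_m m : (nu [set x] <= (q ^+ m)%:E)%E.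
    apply: (@le_trans _ _ (nu (cylinder (letters_upto m x)))).
      apply: le_measure; rewrite ?inE; [exact: set1_measurable | exact: cylinder_measurable |].
      by move=> _ -> k; rewrite tnth_mktuple.
    rewrite nuP lee_fin -[m in q ^+ m]card_ord -prodr_const.
    by apply: ler_prod => k _; rewrite ltW //= pq.
  have fx : nu [set x] \is a fin_num by apply: fin_num_measure; exact: set1_measurable.
  rewrite -(fineK fx) lee_fin.
  have q1' : `|q| < 1 by rewrite ger0_norm.
  have q_cvg := cvg_expr q1'.
  rewrite -(cvg_lim _ q_cvg) //; apply: limr_ge; first by apply/cvg_ex; exists 0.
  by apply: nearW => m; rewrite -lee_fin fineK.
apply: measure_negligible => //.
have [f fA] : exists f : nat -> seqspace n, A `<=` range f.
  have [->|/set0P[a Aa]] := eqVneq A set0; first by exists (fun=> point).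
  move/countable_injP: cA => [g ginj].
  exists ('pinv_(cst a) A g) => x Ax; exists (g x) => //.
  by rewrite pinvKV // inE.
apply: (@negligibleS _ _ _ _ (\bigcup_k [set f k])).
  by move=> x /fA[k _ <-]; exists k.
apply: negligible_bigcup => k; apply/negligibleP; first exact: set1_measurable.
exact: atom.
Qed.

Definition likelier (mu nu : probability (seqspace n) R) m : set (seqspace n) :=
  [set x | (nu (cylinder (letters_upto m x)) < mu (cylinder (letters_upto m x)))%E].

Lemma mem_cylinderP m (u : m.-tuple letters) (x : seqspace n) :
  cylinder u x <-> letters_upto m x = u.
Proof.
split=> [xu|<- k]; last by rewrite tnth_mktuple.
by apply: eq_from_tnth => k; rewrite tnth_mktuple.
Qed.

(** Events determined by the first [m] letters become finite unions of cylinders; this gives both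
    measurability and the union bounds for [likelier]. *)
Lemma prefix_setE m (P : pred (m.-tuple letters)) :
  ([set x | P (letters_upto m x)] : set (seqspace n)) =
  \big[setU/set0]_(u | P u) cylinder u.
Proof.
rewrite -(bigcup_pred P (fun u => cylinder u)); apply/seteqP; split=> [x Px|x [u Pu]].
  by exists (letters_upto m x) => //; exact/(mem_cylinderP _ _).2.
by move=> /(mem_cylinderP _ _).1 ux; rewrite /= ux.
Qed.

Lemma likelierE mu nu m : likelier mu nu m =
  \big[setU/set0]_(u : m.-tuple letters | (nu (cylinder u) < mu (cylinder u))%E)
    cylinder u.
Proof. by rewrite -prefix_setE. Qed.

Lemma likelierCE mu nu m : ~` likelier mu nu m =
  \big[setU/set0]_(u : m.-tuple letters | (mu (cylinder u) <= nu (cylinder u))%E)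
    cylinder u.
Proof.
rewrite -prefix_setE; apply/seteqP; split=> x /=; rewrite /likelier /= leNgt.
  by move/negP.
by move/negP.
Qed.

Lemma likelier_measurable mu nu m : measurable (likelier mu nu m).
Proof.
by rewrite likelierE; apply: bigsetU_measurable => u _; exact: cylinder_measurable.
Qed.

Lemma min_le_sqrt (a b : R) : 0 <= a -> a <= b -> a <= Num.sqrt (a * b).
Proof.
move=> a0 ab; rewrite -{1}(ger0_norm a0) -sqrtr_sqr; apply: ler_wsqrtr.
by rewrite expr2 ler_wpM2l.
Qed.

Section Weights.
Context (mu nu : probability (seqspace n) R) (m : nat).
Context (a b : m.-tuple letters -> R).
Hypothesis a0 : forall u, 0 <= a u.
Hypothesis b0 : forall u, 0 <= b u.
Hypothesis muE : forall u, mu (cylinder u) = (a u)%:E.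
Hypothesis nuE : forall u, nu (cylinder u) = (b u)%:E.

(** On the cylinders of the union [b u < a u], so [b u] is at most the geometric mean; the other
    terms of the affinity sum are nonnegative. *)
Lemma likelier_le : (nu (likelier mu nu m) <= (\sum_u Num.sqrt (a u * b u))%:E)%E.
Proof.
rewrite likelierE.
apply: (le_trans (measure_bigsetU_le _ _ _ (@cylinder_measurable m))).
rewrite (eq_bigr (fun u => (b u)%:E)); last by move=> u _; exact: nuE.
rewrite sumEFin lee_fin [leRHS](bigID (fun u => (nu (cylinder u) < mu (cylinder u))%E)) /=.
rewrite -[leLHS]addr0; apply: lerD; last by apply: sumr_ge0 => u _; exact: sqrtr_ge0.
apply: ler_sum => u; move: (muE u) (nuE u) => -> ->; rewrite lte_fin => /ltW ba.
by rewrite mulrC; exact: min_le_sqrt.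
Qed.

Lemma likelierC_le : (mu (~` likelier mu nu m) <= (\sum_u Num.sqrt (a u * b u))%:E)%E.
Proof.
rewrite likelierCE.
apply: (le_trans (measure_bigsetU_le _ _ _ (@cylinder_measurable m))).
rewrite (eq_bigr (fun u => (a u)%:E)); last by move=> u _; exact: muE.
rewrite sumEFin lee_fin [leRHS](bigID (fun u => (mu (cylinder u) <= nu (cylinder u))%E)) /=.
rewrite -[leLHS]addr0; apply: lerD; last by apply: sumr_ge0 => u _; exact: sqrtr_ge0.
apply: ler_sum => u; move: (muE u) (nuE u) => -> ->; rewrite lee_fin => ba.
exact: min_le_sqrt.
Qed.

End Weights.
End SeqSpace.

(** * Continuity of the projection *)

Section Projection.
Context (n : nat).
Local Notation letters := 'I_n.+2.

(* The alphabet is discrete, so that this is the usual topology of the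
   symbolic space; [seqspace n] only carries the sigma-algebra. *)
Definition symbolic : Type :=
  prod_topology (fun _ : nat => discrete_topology letters).
HB.instance Definition _ := Topological.on symbolic.

Lemma symbolic_compact : compact [set: symbolic].
Proof.
have fin (k : nat) : finite_set [set: discrete_topology letters].
  exact: (@finite_finset letters).
have := tychonoff (fun k => finite_compact (fin k)).
by set A := (X in compact X -> _); suff -> : A = [set: symbolic] by []; exact/seteqP.
Qed.

Lemma nbhs_letters (x : symbolic) m :
  \forall z \near x, forall k, (k < m)%N -> z k = x k.
Proof.
have x_filter : Filter (nbhs x) := nbhs_filter x.
elim: m => [|m IH]; first by apply: (@filterE _ (nbhs x)) => z k; rewrite ltn0.
have zm : \forall z \near x, z m = x m.
  have := @proj_continuous nat (fun _ => discrete_topology letters) m x.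
  by move=> /(_ [set x m] (discrete_set1 _)).
apply: filterS2 IH zm => z zx zm k; rewrite ltnS leq_eqVlt => /predU1P[-> //|].
exact: zx.
Qed.

Lemma finite_letters_closed (A : set symbolic) m :
  (forall x z : symbolic, (forall k, (k < m)%N -> z k = x k) -> A z -> A x) ->
  closed A.
Proof.
move=> Adep; rewrite -[A]setCK; apply: open_closedC; rewrite openE => x nAx.
apply: filterS (nbhs_letters x m) => z zx Az; apply: nAx.
exact: Adep zx Az.
Qed.

Context (R : realType) (d : nat).

(** Bridge between the two norms: similitudes contract the Euclidean norm, while balls are taken in
    the sup norm. *)
Lemma eucl_norm_coord_le (u : 'rV[R]_d) k : `|u 0 k| <= eucl_norm u.
Proof.
rewrite -sqrtr_sqr; apply: ler_wsqrtr; rewrite (bigD1 k) //= lerDl.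
by apply: sumr_ge0 => j _; exact: sqr_ge0.
Qed.

Lemma compact_eucl_bounded (K : set 'rV[R]_d) : compact K ->
  exists2 M : R, 0 <= M & forall u v, K u -> K v -> eucl_norm (u - v) <= M.
Proof.
move=> /compact_bounded[M [_ KM]].
pose B := `|M| + 1.
have MB : M < B by rewrite /B (le_lt_trans (ler_norm M)) // ltrDl.
have B0 : 0 <= B by rewrite /B addr_ge0.
have coord u k : K u -> `|u 0 k| <= B.
  move=> /(KM _ MB); apply: le_trans.
  rewrite [leRHS]/Num.norm /= mx_normrE.
  exact: (le_bigmax _ (fun ij : 'I_1 * 'I_d => `|u ij.1 ij.2|) (0, k)).
(* Coordinates of points of [K] lie in [[-B, B]], so they differ by at most [B + B]. *)
exists (Num.sqrt (\sum_(k < d) (B + B) ^+ 2)); first exact: sqrtr_ge0.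
move=> u v Ku Kv; apply: ler_wsqrtr; apply: ler_sum => k _.
rewrite !mxE -(real_normK (num_real (u 0 k - v 0 k))).
rewrite lerXn2r ?nnegrE ?addr_ge0 //.
by apply: (le_trans (ler_normB _ _)); apply: lerD; exact: coord.
Qed.

Context (r : R) (S : letters -> 'rV[R]_d -> 'rV[R]_d) (K : set 'rV[R]_d).
Context (pi : (nat -> letters) -> 'rV[R]_d).
Hypothesis r01 : 0 < r < 1.
Hypothesis Ssim : forall i, similitude r (S i).
Hypothesis Kcpt : compact K.
Hypothesis piP : natural_projection S K pi.

(** Each common first letter is stripped at the cost of a factor [r]; the remaining tails project
    into [K]. *)
Lemma projection_contract (M : R) m (x z : nat -> letters) :
  (forall u v, K u -> K v -> eucl_norm (u - v) <= M) ->
  (forall k, (k < m)%N -> z k = x k) -> eucl_norm (pi x - pi z) <= r ^+ m * M.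
Proof.
move=> KM; elim: m x z => [|m IH] x z zx.
  by rewrite mul1r; apply: KM; exact: piP.1.
have sconsE (t : nat -> letters) : t = scons (t 0%N) (fun k => t k.+1).
  by apply/funext => -[].
rewrite (sconsE x) (sconsE z) !piP.2 zx // Ssim exprS -mulrA.
rewrite ler_pM2l; last by have /andP[] := r01.
by apply: IH => k km; exact: zx.
Qed.

Lemma projection_continuous : continuous (pi : symbolic -> 'rV[R]_d).
Proof.
move=> x; have x_filter : Filter (nbhs (x : symbolic)) := nbhs_filter (x : symbolic).
apply/(@cvg_ballP _ _ _ (nbhs (x : symbolic)) x_filter) => e e0.
have [M M0 KM] := compact_eucl_bounded Kcpt.
have [m rm] : exists m, r ^+ m * M < e.
  have /andP[r0 r1] := r01.
  have /cvg_expr r_cvg : `|r| < 1 by rewrite gtr0_norm.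
  (* [M] may be 0, so the division below is by [M + 1]. *)
  have M1 : 0 < M + 1 by rewrite ltr_wpDl.
  have eM : 0 < e / (M + 1) by rewrite divr_gt0.
  have /cvgrPdist_lt/(_ _ eM)[m _ /(_ m (leqnn m)) /=] := r_cvg.
  rewrite sub0r normrN ger0_norm ?exprn_ge0 ?ltW // ltr_pdivlMr // => rm.
  exists m; apply: le_lt_trans rm; rewrite ler_wpM2l ?exprn_ge0 ?ltW //.
  by rewrite ltrDl.
apply: filterS (nbhs_letters x m) => z zx; split=> // i j.
rewrite /ball /= (ord1 i).
apply: (@le_lt_trans _ _ (eucl_norm (pi x - pi z))).
  by have := eucl_norm_coord_le (pi x - pi z) j; rewrite !mxE.
exact: le_lt_trans (projection_contract KM zx) rm.
Qed.

(** A closed subset of the compact symbolic space is compact, and so is its continuous image, which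
    is therefore closed. *)
Lemma projection_closed_measurable (F : set symbolic) : closed F ->
  measurable (pi @` F : set (borel_rV R d)).
Proof.
move=> Fcl; rewrite -[X in measurable X]setCK; apply: measurableC.
apply: sub_gen_smallest; rewrite -closedC setCK.
apply: compact_closed; first exact: norm_hausdorff.
apply: continuous_compact; first exact: continuous_subspaceT projection_continuous.
exact: subclosed_compact Fcl symbolic_compact _.
Qed.

End Projection.

(** * Uniform loss of affinity on the orbit, and the conclusion *)

Lemma reach_step (n : nat) (Y : Type) (H : 'I_n.+2 -> Y -> Y) y i z :
  reach H y z -> reach H y (H i z).
Proof.
move=> [v v1 ->]; exists (rcons v i); first by rewrite size_rcons.
by rewrite /Hcomp foldl_rcons.
Qed.

Lemma reach_affinity_le (R : realType) (n : nat) (Y : Type)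
    (H : 'I_n.+2 -> Y -> Y) (G : 'I_n.+2 -> Y -> R) (p : 'I_n.+2 -> R)
    (y : Y) (eps : R) (w : seq 'I_n.+2) :
  (forall i z, 0 <= G i z <= 1) -> (forall z, \sum_i G i z = 1) ->
  (forall i, 0 < p i) -> \sum_i p i = 1 -> 0 < eps ->
  reach H y
      `&` \bigcap_i (G i @^-1` `[p i - eps, p i + eps])
      `&` \bigcap_j ((G j \o Hcomp H w) @^-1` `[p j - eps, p j + eps])
      = set0 ->
  exists2 c : R, 0 < c < 1 &
    forall z, reach H y z -> affinity H G p (size w).+1 z <= c.
Proof.
move=> G01 Gsum p0 p1 eps0 Hempty.
pose del := eps ^+ 2 / 8; pose W := \prod_(i <- w) (p i / 2).
have dev z : reach H y z -> affinity H G p 1 z <= 1 - del \/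
    affinity H G p 1 (Hcomp H w z) <= 1 - del.
  move=> yz; apply: contrapT => /not_orP[nz nw].
  have near u : ~ (affinity H G p 1 u <= 1 - del) ->
      forall i, p i - eps <= G i u <= p i + eps.
    move=> nu i; rewrite -ler_distl leNgt; apply/negP => gt.
    exact: nu (affinity1_le H G01 Gsum p0 p1 eps0 gt).
  suff : set0 z by [].
  rewrite -Hempty; split; first split=> //.
    by move=> i _ /=; rewrite in_itv /=; exact: near.
  by move=> j _ /=; rewrite in_itv /=; exact: near.
have /andP[W0 W1] : 0 < W <= 1.
  rewrite /W; elim: w {Hempty W dev} => [|j v /andP[h0 h1]].
    by rewrite big_nil ltr01 lexx.
  have pj := p0 j; have pj1 := p_le1 p0 p1 j.
  by rewrite big_cons; apply/andP; split; nra.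
have del0 : 0 < del by rewrite /del divr_gt0 // exprn_gt0.
(* A point of the orbit is required to deduce [del <= 1] from [0 <= affinity <= 1 - del]; [y] itself
   may lie outside [reach H y]. *)
have y1 : reach H y (H ord0 y) by exists [:: ord0].
have del1 : del <= 1.
  rewrite -subr_ge0.
  by case: (dev _ y1) => /(le_trans _); apply; exact: affinity_ge0.
(* Halving the loss keeps the bound strictly positive even if [del * W = 1]. *)
exists (1 - del * W / 2); first by apply/andP; split; nra.
move=> z yz; apply: (@le_trans _ _ (1 - del * W)); last by nra.
case: (dev _ yz) => le_z.
  apply: (le_trans (affinityS_le H G01 Gsum p0 p1 _ _)).
  by apply: (le_trans le_z); nra.
by apply: affinity_word_le => //; rewrite del1 ltW.
Qed.

Theorem proposition3p3 (R : realType) (n d : nat)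
    (r : R) (S : 'I_n.+2 -> 'rV[R]_d -> 'rV[R]_d) (K : set 'rV[R]_d)
    (pi : (nat -> 'I_n.+2) -> 'rV[R]_d)
    (r01 : 0 < r < 1)
    (Ssim : forall i, similitude r (S i))
    (Sosc : open_set_condition S)
    (Katt : attractor S K)
    (piP : natural_projection S K pi)
    (Y : Type) (H : 'I_n.+2 -> Y -> Y) (G : 'I_n.+2 -> Y -> R)
    (G01 : forall i y, 0 <= G i y <= 1)
    (Gsum : forall y, \sum_i G i y = 1)
    (y : Y) (nu_y : probability (seqspace n) R) (nu_yP : is_nu H G y nu_y)
    (p : 'I_n.+2 -> R) (p_gt0 : forall i, 0 < p i) (psum : \sum_i p i = 1)
    (nu_p : probability (seqspace n) R) (nu_pP : is_bernoulli p nu_p)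
    (eps0 : R) (eps0_gt0 : 0 < eps0)
    (l : nat) (l_ge1 : (1 <= l)%N) (w : l.-tuple 'I_n.+2)
    (Hempty : reach H y
      `&` \bigcap_i (G i @^-1` `[p i - eps0, p i + eps0])
      `&` \bigcap_j ((G j \o Hcomp H w) @^-1` `[p j - eps0, p j + eps0])
      = set0) :
  mutually_singular nu_y nu_p /\
  ((forall A : set (nat -> 'I_n.+2), countable (pi @^-1` (pi @` A) `\` A)) ->
   mutually_singular (pushforward nu_y (pi : seqspace n -> borel_rV R d))
                     (pushforward nu_p (pi : seqspace n -> borel_rV R d))).
Proof.
have [c c01 zc] := reach_affinity_le G01 Gsum p_gt0 psum eps0_gt0 Hempty.
have /andP[c0 c1] := c01.
(* The extra letter moves [y] into [reach H y], which consists of images under nonempty words; then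
   come [k] blocks, each contributing a factor [c]. *)
pose M k := (k * (size w).+1).+1.
have affM k : affinity H G p (M k) y <= c ^+ k.
  rewrite /M [affinity _ _ _ _ _]/=.
  apply: (@le_trans _ _ (affinity H G p 1 y * c ^+ k)); last first.
    by rewrite ler_piMl ?exprn_ge0 ?affinity_le1 ?ltW.
  rewrite /= mulr_suml; apply: ler_sum => i _; rewrite mulr1.
  rewrite ler_wpM2l ?sqrtr_ge0 //.
  apply: (affinity_muln_le (Z := reach H y)) => //; first exact: ltW.
    by move=> j u; exact: reach_step.
  by exists [:: i].
pose C k := likelier nu_y nu_p (M k).
have a0 := @nu_weight_ge0 _ _ _ H G G01 y.
have b0 := @bernoulli_weight_ge0 _ _ p p_gt0.
have nuC k : (nu_p (C k) <= (c ^+ k)%:E)%E.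
  have := likelier_le (b0 (M k)) (nu_yP (M k)) (nu_pP (M k)).
  by move/le_trans; apply; rewrite lee_fin affinity_tuple.
have muC k : (nu_y (~` C k) <= (c ^+ k)%:E)%E.
  have := likelierC_le (a0 (M k)) (nu_yP (M k)) (nu_pP (M k)).
  by move/le_trans; apply; rewrite lee_fin affinity_tuple.
have mC k : measurable (C k) by exact: likelier_measurable.
pose F k : set (seqspace n) := \bigcap_(j >= k) C j.
have [y0 p0] : nu_y (~` \bigcup_k F k) = 0%E /\ nu_p (\bigcup_k F k) = 0%E.
  exact: singular_of_geometric c01 mC muC nuC.
have mF : measurable (\bigcup_k F k).
  apply: bigcup_measurable => k _; apply: bigcap_measurable => //.
  by exists k => /=.
split; first by exists (~` \bigcup_k F k); rewrite setCK; split=> //; exact: measurableC.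
move=> pi_ctbl.
have [Kcpt _ _] := Katt.
have mE k : measurable (pi @` F k : set (borel_rV R d)).
  apply: (projection_closed_measurable r01 Ssim Kcpt piP).
  (* Each [C j] depends on the first [M j] letters only, so [F k] is an intersection of closed
     sets. *)
  apply: closed_bigI => j _.
  apply: (@finite_letters_closed n _ (M j)) => x z zx.
  rewrite /C /likelier /=; suff -> : letters_upto (M j) x = letters_upto (M j) z by [].
  by apply: eq_mktuple => i; rewrite zx.
exists (~` (pi @` \bigcup_k F k)).
set Q : set (seqspace n) := pi @^-1` (pi @` \bigcup_k F k) `\` \bigcup_k F k.
have mQ : measurable Q.
  by apply: countable_measurable; [exact: set1_measurable | exact: pi_ctbl].
have preE : pi @^-1` (pi @` \bigcup_k F k) = \bigcup_k F k `|` Q.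
  by rewrite /Q setDUK // => x Fx; exists x.
rewrite setCK; split.
- by apply: measurableC; rewrite image_bigcup; exact: bigcup_measurable.
(* Adding [Q] only shrinks the complement, so this set is null even if [nu_y] charges [Q]. *)
- rewrite /pushforward preimage_setC.
  change (nu_y (~` (pi @^-1` (pi @` \bigcup_k F k) : set (seqspace n))) = 0%E).
  rewrite preE.
  apply: (subset_measure0 _ _ _ y0); [|exact: measurableC|].
    by apply: measurableC; exact: measurableU.
  by apply: subsetC; exact: subsetUl.
- rewrite /pushforward.
  change (nu_p (pi @^-1` (pi @` \bigcup_k F k) : set (seqspace n)) = 0%E).
  rewrite preE.
  apply: measure_negligible; first exact: measurableU.
  apply: negligibleU; first exact/negligibleP.
  by apply/negligibleP => //; apply: (bernoulli_countable0 p_gt0 psum nu_pP (pi_ctbl _)).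
Qed.
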